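(* Let $A,B$ be finite-dimensional complex vector spaces. Let $\lambda,\lambda',\mu,\mu'$ be partitions such that $\lambda'$ is obtained by suppressing one box of $\lambda$ and $\mu'$ is obtained by adding one box to $\mu$. Let $$\Theta:\mathrm{Hom}(A,B)\otimes S_\lambda A\otimes S_\mu B\to S_{\lambda'}A\otimes S_{\mu'}B$$ be the unique (up to scale) nonzero $GL(A)\times GL(B)$-equivariant morphism, and for $X\in \mathrm{Hom}(A,B)$ let $\Theta_X: S_\lambda A\otimes S_\mu B\to S_{\lambda'}A\otimes S_{\mu'}B$ be the induced morphism. Then the rank of $\Theta_X$ only depends on the rank of $X$. As a consequence, if $M\subset\mathrm{Hom}(A,B)$ is a linear space of morphisms of constant rank, then $\Theta_M=\{\Theta_X: X\in M\}$ is also a linear space of morphisms of constant rank.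
   Context: $S_\lambda A$ denotes the Schur module of $GL(A)$ associated with the partition $\lambda$ (partitions are identified with their Young diagrams; the lengths of the partitions are assumed to be at most the dimensions of the corresponding spaces). A linear space of morphisms has constant rank if all its nonzero elements have the same rank; for the family $\Theta_M$, parametrized linearly by $M$, this means that $\Theta_X$ has the same rank for all nonzero $X\in M$. *)

(* Defs.v *)
From HB Require Import structures.
From mathcomp Require Import all_boot all_order all_fingroup all_algebra.

Set Implicit Arguments.
Unset Strict Implicit.
Unset Printing Implicit Defensive.

Import GRing.Theory.

Local Open Scope ring_scope.

(* A partition is the weakly decreasing sequence of its nonzero parts, so that
   its length is [size la]. *)
Definition is_partition (la : seq nat) : bool :=
  sorted geq la && (0 \notin la)%N.

(* The Young diagram of la; (i, j) is the box in row i and column j, counted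
   from 0. *)
Definition young (la : seq nat) : pred (nat * nat) :=
  [pred b | b.2 < nth 0 la b.1]%N.

(* la' is obtained by suppressing one box of la. *)
Definition remove_box (la la' : seq nat) : Prop :=
  exists2 b, b \in young la & young la' =i [predD1 young la & b].

(* mu' is obtained by adding one box to mu. *)
Definition add_box (mu mu' : seq nat) : Prop :=
  exists2 b, b \notin young mu & young mu' =i [predU1 b & young mu].

(* The boxes of the Young diagram of la, as a finite type: the tag is the row
   and the tagged component is the column. *)
Definition box (la : seq nat) : finType :=
  {i : 'I_(size la) & 'I_(nth 0%N la i)}.

Section Tensor.

Variable K : fieldType.
Implicit Types U V W : vectType K.

Definition bvec V (i : 'I_(\dim {:V})) : V := (vbasis {:V})`_i.
Definition bcoord V (i : 'I_(\dim {:V})) (v : V) : K := coord (vbasis {:V}) i v.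

(* The tensor product of V and W, by coordinates in the bases bvec; its
   universal property is tens_liftE together with tens_lfunP. *)
Definition tens V W : vectType K := 'M[K]_(\dim {:V}, \dim {:W}).

Definition tpair V W (v : V) (w : W) : tens V W :=
  \matrix_(i, j) (bcoord i v * bcoord j w).

Definition tens_lift_fun V W U (beta : V -> W -> U) (T : tens V W) : U :=
  \sum_i \sum_j T i j *: beta (bvec i) (bvec j).

(* The linear map on V (x) W induced by a bilinear map beta. *)
Definition tens_lift V W U (beta : V -> W -> U) : 'Hom(tens V W, U) :=
  linfun (tens_lift_fun beta).

Definition tens_map V W V' W' (f : 'Hom(V, V')) (g : 'Hom(W, W')) :
  'Hom(tens V W, tens V' W') := tens_lift (fun v w => tpair (f v) (g w)).

(* The tensor power of V with factors indexed by the finite type I, by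
   coordinates in the basis bvec. *)
Definition tpow (I : finType) V : vectType K :=
  {ffun {ffun I -> 'I_(\dim {:V})} -> K^o}.

Definition tpure (I : finType) V (v : I -> V) : tpow I V :=
  [ffun k : {ffun I -> 'I_(\dim {:V})} => \prod_i bcoord (k i) (v i)].

Definition tpow_map_fun (I : finType) V V' (g : 'Hom(V, V')) (T : tpow I V) :
  tpow I V' := \sum_k T k *: tpure (fun i => g (bvec (k i))).

Definition tpow_map (I : finType) V V' (g : 'Hom(V, V')) :
  'Hom(tpow I V, tpow I V') := linfun (tpow_map_fun g).

(* The action of permutations by place permutation, see tplace_pure. *)
Definition tplace (I : finType) V (s : {perm I}) (T : tpow I V) : tpow I V :=
  [ffun k : {ffun I -> 'I_(\dim {:V})} => T [ffun i => k (s i)]].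

End Tensor.

Arguments tpair {K V W} v w.
Arguments tpure {K I V} v.

Section Schur.

Variable K : fieldType.

Definition row_perm (la : seq nat) (p : {perm box la}) : bool :=
  [forall b, tag (p b) == tag b].

Definition col_perm (la : seq nat) (q : {perm box la}) : bool :=
  [forall b, (tagged (q b) == tagged b :> nat)].

(* The Young symmetrizer: symmetrize along the rows, then antisymmetrize along
   the columns. *)
Definition young_sym_fun (la : seq nat) (V : vectType K) (T : tpow (box la) V) :
  tpow (box la) V :=
  \sum_(q | @col_perm la q) (-1) ^+ q *:
    tplace q (\sum_(p | @row_perm la p) tplace p T).

Definition young_sym (la : seq nat) (V : vectType K) : 'End(tpow (box la) V) :=
  linfun (@young_sym_fun la V).

(* The Schur module, as the image of the Young symmetrizer.  This is the right
   object in characteristic 0. *)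
Definition schur (la : seq nat) (V : vectType K) : vectType K :=
  subvs_of (limg (young_sym la V)).

Definition schur_map_fun (la : seq nat) (V : vectType K) (g : 'End(V))
    (u : schur la V) : schur la V :=
  vsproj (limg (young_sym la V)) (tpow_map (box la) g (vsval u)).

(* The restriction to the Schur module of the action of g on the tensor power;
   the projection is harmless by schur_mapE. *)
Definition schur_map (la : seq nat) (V : vectType K) (g : 'End(V)) :
  'End(schur la V) := linfun (schur_map_fun (la := la) g).

End Schur.

Section Equivariance.

Variable K : fieldType.
Implicit Types A B V W U : vectType K.

Definition in_GL V (g : 'End(V)) : bool := lker g == 0%VS.

Definition rank V W (f : 'Hom(V, W)) : nat := \dim (limg f).

Definition hom_map_fun A B (g : 'End(A)) (h : 'End(B)) (X : 'Hom(A, B)) :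
  'Hom(A, B) := (h \o X \o g^-1)%VF.

Definition hom_map A B (g : 'End(A)) (h : 'End(B)) : 'End('Hom(A, B)) :=
  linfun (hom_map_fun g h).

Definition equivariant A B (la la' mu mu' : seq nat)
    (Theta : 'Hom(tens 'Hom(A, B) (tens (schur la A) (schur mu B)),
                  tens (schur la' A) (schur mu' B))) : Prop :=
  forall (g : 'End(A)) (h : 'End(B)), in_GL g -> in_GL h ->
    (Theta \o tens_map (hom_map g h)
                (tens_map (schur_map la g) (schur_map mu h)) =
     tens_map (schur_map la' g) (schur_map mu' h) \o Theta)%VF.

(* slice Theta X is the map w |-> Theta (X (x) w). *)
Definition slice V W U (Theta : 'Hom(tens V W, U)) (X : V) : 'Hom(W, U) :=
  linfun (fun w => Theta (tpair X w)).

(* The linear space of the maps slice Theta X, for X in M. *)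
Definition slice_space V W U (Theta : 'Hom(tens V W, U)) (M : {vspace V}) :
  {vspace 'Hom(W, U)} := (linfun (slice Theta) @: M)%VS.

(* The rank of F X is the same for all nonzero parameters X in M. *)
Definition constant_rank_family V W U (M : {vspace V}) (F : V -> 'Hom(W, U)) :
  Prop :=
  forall X Y, X \in M -> Y \in M -> X != 0 -> Y != 0 -> rank (F X) = rank (F Y).

Definition constant_rank W U (M : {vspace 'Hom(W, U)}) : Prop :=
  constant_rank_family M id.

End Equivariance.

(* Facts showing that the definitions above, in particular those that use
   linfun and vsproj, have the intended meaning. *)

Section Facts.

Variable K : fieldType.
Implicit Types U V W : vectType K.

Lemma bcoordD V i a (u v : V) :
  bcoord i (a *: u + v) = a * bcoord i u + bcoord i v.
Proof. by rewrite /bcoord linearP. Qed.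

Lemma bcoord_sum V (v : V) : v = \sum_i bcoord i v *: bvec i.
Proof. exact: coord_vbasis (memvf v). Qed.

Lemma bcoord_bvec V (i j : 'I_(\dim {:V})) : bcoord i (bvec j) = (j == i)%:R.
Proof. by rewrite /bcoord /bvec coord_free ?(basis_free (vbasisP _)). Qed.

Lemma tens_lift_is_linear V W U (beta : V -> W -> U) :
  linear (tens_lift_fun beta).
Proof.
move=> a S T; rewrite /tens_lift_fun scaler_sumr -big_split.
apply: eq_bigr => i _.
rewrite scaler_sumr -big_split; apply: eq_bigr => j _.
by rewrite !mxE scalerDl scalerA.
Qed.

HB.instance Definition _ V W U (beta : V -> W -> U) :=
  GRing.isLinear.Build K (tens V W) U _ (tens_lift_fun beta)
    (tens_lift_is_linear beta).

Lemma tpair_linearl V W (w : W) : linear (fun v : V => tpair v w).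
Proof.
by move=> a u v; apply/matrixP => i j; rewrite !mxE bcoordD mulrDl mulrA.
Qed.

Lemma tpair_linearr V W (v : V) : linear (fun w : W => tpair v w).
Proof.
by move=> a u w; apply/matrixP => i j; rewrite !mxE bcoordD mulrDr mulrCA.
Qed.

Lemma tens_liftE V W U (beta : V -> W -> U) :
    (forall w, linear (beta^~ w)) -> (forall v, linear (beta v)) ->
  forall v w, tens_lift beta (tpair v w) = beta v w.
Proof.
move=> linl linr v w; rewrite lfunE /= /tens_lift_fun.
pose bl w := HB.pack (beta^~ w) (GRing.isLinear.Build K V U _ _ (linl w))
  : {linear V -> U}.
pose br v := HB.pack (beta v) (GRing.isLinear.Build K W U _ _ (linr v))
  : {linear W -> U}.
rewrite [RHS](_ : _ = bl w v) // {2}[v]bcoord_sum linear_sum.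
apply: eq_bigr => i _; rewrite linearZ /=.
rewrite [beta _ w](_ : _ = br (bvec i) w) // {2}[w]bcoord_sum linear_sum.
rewrite scaler_sumr; apply: eq_bigr => j _.
by rewrite linearZ mxE scalerA.
Qed.

Lemma tens_sum V W (T : tens V W) :
  T = \sum_i \sum_j T i j *: tpair (bvec i) (bvec j).
Proof.
apply/matrixP => k l; rewrite summxE (bigD1 k) //= summxE (bigD1 l) //=.
rewrite !mxE !bcoord_bvec !eqxx !mulr1 big1 ?addr0 => [|j nj]; last first.
  by rewrite !mxE !bcoord_bvec (negPf nj) !mulr0.
rewrite big1 ?addr0 // => i ni; rewrite summxE big1 // => j _.
by rewrite !mxE !bcoord_bvec (negPf ni) mul0r mulr0.
Qed.

Lemma tens_lfunP V W U (f g : 'Hom(tens V W, U)) :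
  (forall v w, f (tpair v w) = g (tpair v w)) -> f = g.
Proof.
move=> fg; apply/lfunP => T; rewrite [T]tens_sum !linear_sum.
apply: eq_bigr => i _; rewrite !linear_sum; apply: eq_bigr => j _.
by rewrite !linearZ /= fg.
Qed.

Lemma tens_mapE V W V' W' (f : 'Hom(V, V')) (g : 'Hom(W, W')) v w :
  tens_map f g (tpair v w) = tpair (f v) (g w).
Proof.
rewrite /tens_map tens_liftE // => [{}w|{}v] a x y.
  by rewrite linearP; apply: tpair_linearl.
by rewrite linearP; apply: tpair_linearr.
Qed.

Lemma tpow_map_is_linear (I : finType) V V' (g : 'Hom(V, V')) :
  linear (@tpow_map_fun K I V V' g).
Proof.
move=> a S T; rewrite /tpow_map_fun scaler_sumr -big_split.
apply: eq_bigr => k _.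
by rewrite !ffunE scalerDl scalerA.
Qed.

HB.instance Definition _ (I : finType) V V' (g : 'Hom(V, V')) :=
  GRing.isLinear.Build K (tpow I V) (tpow I V') _ (@tpow_map_fun K I V V' g)
    (tpow_map_is_linear g).

Lemma tpureE (I : finType) V (v : I -> V) k :
  tpure v k = \prod_i bcoord (k i) (v i).
Proof. by rewrite ffunE. Qed.

Lemma tpowZE (I : finType) V a (T : tpow I V) k : (a *: T) k = a * T k.
Proof. by rewrite ffunE. Qed.

Lemma tpow_sumE (I J : finType) V (a : J -> K) (T : J -> tpow I V) k :
  (\sum_j a j *: T j) k = \sum_j a j * T j k.
Proof. by rewrite sum_ffunE; apply: eq_bigr => j _; rewrite tpowZE. Qed.

Lemma tpow_mapE (I : finType) V V' (g : 'Hom(V, V')) (v : I -> V) :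
  tpow_map I g (tpure v) = tpure (fun i => g (v i)).
Proof.
rewrite lfunE /= /tpow_map_fun; apply/ffunP => l; rewrite tpow_sumE tpureE.
transitivity (\sum_(k : {ffun I -> _}) \prod_i (bcoord (k i) (v i) *
    bcoord (l i) (g (bvec (k i))))).
  by apply: eq_bigr => k _; rewrite big_split; congr (_ * _); exact: tpureE.
rewrite -(bigA_distr_bigA
  (fun i j => bcoord j (v i) * bcoord (l i) (g (bvec j)))) /=.
apply: eq_bigr => i _; rewrite {2}[v i]bcoord_sum linear_sum /bcoord linear_sum.
by apply: eq_bigr => j _; rewrite !linearZ.
Qed.

Lemma tpow_sum (I : finType) V (T : tpow I V) :
  T = \sum_k T k *: tpure (fun i => bvec (k i)).
Proof.
apply/ffunP => l; rewrite tpow_sumE (bigD1 l) //= big1 ?addr0 => [|k nk].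
  rewrite tpureE big1 => [|i _]; last by rewrite bcoord_bvec eqxx.
  by rewrite mulr1.
rewrite tpureE; have [i ni] : exists i, k i != l i.
  apply/existsP; apply: contraR nk; rewrite negb_exists => /forallP kl.
  by apply/eqP/ffunP => i; apply/eqP; have := kl i; rewrite negbK.
by rewrite (bigD1 i) //= bcoord_bvec (negPf ni) mul0r mulr0.
Qed.

Lemma tpow_lfunP (I : finType) V U (f g : 'Hom(tpow I V, U)) :
  (forall v, f (tpure v) = g (tpure v)) -> f = g.
Proof.
move=> fg; apply/lfunP => T; rewrite [T]tpow_sum !linear_sum.
by apply: eq_bigr => k _; rewrite !linearZ /= fg.
Qed.

Lemma tplace_is_linear (I : finType) V (s : {perm I}) :
  linear (@tplace K I V s).
Proof. by move=> a S T; apply/ffunP => k; rewrite !ffunE. Qed.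

HB.instance Definition _ (I : finType) V (s : {perm I}) :=
  GRing.isLinear.Build K (tpow I V) (tpow I V) _ (@tplace K I V s)
    (@tplace_is_linear I V s).

Lemma tplace_pure (I : finType) V (s : {perm I}) (v : I -> V) :
  tplace s (tpure v) = tpure (fun i => v ((s^-1)%g i)).
Proof.
apply/ffunP => k; rewrite !ffunE [RHS](reindex_inj (@perm_inj _ s)).
by apply: eq_bigr => i _; rewrite ffunE permK.
Qed.

Lemma tplace_map (I : finType) V V' (s : {perm I}) (g : 'Hom(V, V'))
    (T : tpow I V) :
  tplace s (tpow_map I g T) = tpow_map I g (tplace s T).
Proof.
rewrite [T]tpow_sum !linear_sum; apply: eq_bigr => k _.
by rewrite !linearZ /= !(tpow_mapE, tplace_pure).
Qed.

Lemma young_sym_is_linear la V : linear (@young_sym_fun K la V).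
Proof.
move=> a S T; rewrite /young_sym_fun scaler_sumr -big_split.
apply: eq_bigr => q _.
rewrite /= scalerA mulrC -scalerA -scalerDr -linearP scaler_sumr -big_split.
by congr (_ *: tplace _ _); apply: eq_bigr => p _; rewrite linearP.
Qed.

HB.instance Definition _ la V :=
  GRing.isLinear.Build K (tpow (box la) V) (tpow (box la) V) _
    (@young_sym_fun K la V) (@young_sym_is_linear la V).

Lemma young_sym_map la V (g : 'End(V)) T :
  young_sym la V (tpow_map (box la) g T) =
  tpow_map (box la) g (young_sym la V T).
Proof.
rewrite [LHS]lfunE [young_sym la V T]lfunE /= /young_sym_fun [RHS]linear_sum.
apply: eq_bigr => q _; rewrite [RHS]linearZ /=; congr (_ *: _).
apply: etrans (tplace_map q g _); congr (tplace _ _); rewrite linear_sum.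
by apply: eq_bigr => p _; exact: tplace_map.
Qed.

Lemma schur_map_is_linear la V (g : 'End(V)) :
  linear (@schur_map_fun K la V g).
Proof. by move=> a u v; rewrite /schur_map_fun !linearP. Qed.

HB.instance Definition _ la V (g : 'End(V)) :=
  GRing.isLinear.Build K (schur la V) (schur la V) _ (@schur_map_fun K la V g)
    (@schur_map_is_linear la V g).

Lemma schur_mapE la V (g : 'End(V)) (u : schur la V) :
  vsval (schur_map la g u) = tpow_map (box la) g (vsval u).
Proof.
rewrite lfunE /= vsprojK //.
by have /memv_imgP[T _ ->] := subvsP u; rewrite -young_sym_map memv_img ?memvf.
Qed.

Lemma hom_map_is_linear (A B : vectType K) (g : 'End(A)) (h : 'End(B)) :
  linear (hom_map_fun g h).
Proof.
move=> a X Y; rewrite /hom_map_fun.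
by rewrite comp_lfunDr -comp_lfunZr comp_lfunDl -comp_lfunZl.
Qed.

HB.instance Definition _ (A B : vectType K) (g : 'End(A)) (h : 'End(B)) :=
  GRing.isLinear.Build K 'Hom(A, B) 'Hom(A, B) _ (hom_map_fun g h)
    (hom_map_is_linear g h).

Lemma hom_mapE (A B : vectType K) (g : 'End(A)) (h : 'End(B)) X :
  hom_map g h X = (h \o X \o g^-1)%VF.
Proof. by rewrite lfunE. Qed.

Lemma sliceE V W U (Theta : 'Hom(tens V W, U)) X w :
  slice Theta X w = Theta (tpair X w).
Proof.
have lin : linear (fun w => Theta (tpair X w)).
  by move=> a u v; rewrite tpair_linearr linearP.
pose f := HB.pack (fun w => Theta (tpair X w))
  (GRing.isLinear.Build K W U _ _ lin) : {linear W -> U}.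
exact: (lfunE f).
Qed.

Lemma slice_is_linear V W U (Theta : 'Hom(tens V W, U)) :
  linear (slice Theta).
Proof.
move=> a X Y; apply/lfunP => w; rewrite !(sliceE, add_lfunE, scale_lfunE).
by rewrite (tpair_linearl w) linearP.
Qed.

HB.instance Definition _ V W U (Theta : 'Hom(tens V W, U)) :=
  GRing.isLinear.Build K V 'Hom(W, U) _ (slice Theta) (slice_is_linear Theta).

Lemma slice_spaceP V W U (Theta : 'Hom(tens V W, U)) (M : {vspace V}) f :
  reflect (exists2 X, X \in M & f = slice Theta X) (f \in slice_space Theta M).
Proof.
apply: (iffP memv_imgP) => -[X MX ->]; exists X => //; first by rewrite lfunE.
by rewrite [RHS]lfunE.
Qed.

End Facts.

(* Main.v *)
(* Two morphisms X, Y of the same rank are related by Y = h X g^-1 with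
   (g, h) in GL(A) x GL(B), and equivariance then makes Theta_Y the composite
   of Theta_X with the invertible actions of (g, h) on its source and target. *)
Require Import Defs.
From mathcomp Require Import all_boot all_order all_algebra.
From mathcomp Require Import reals complex.

Set Implicit Arguments.
Unset Strict Implicit.

Import GRing.Theory VectorInternalTheory.

Local Open Scope ring_scope.
Local Open Scope complex_scope.

Lemma cancel_lker0 (K : fieldType) (V W : vectType K)
    (f : 'Hom(V, W)) (f' : 'Hom(W, V)) :
  (f' \o f = \1)%VF -> lker f == 0%VS.
Proof.
move=> f'f; apply/lker0P => u v fuv.
by rewrite -[u]id_lfunE -[v]id_lfunE -f'f !comp_lfunE fuv.
Qed.

Section TensorPowers.

Variable K : fieldType.
Implicit Types V W : vectType K.

(** By functoriality [tens_map f^-1 g^-1] is a left inverse, which need only be checked on pure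
    tensors. *)
Lemma tens_map_lker0 V W (f : 'End(V)) (g : 'End(W)) :
  lker f == 0%VS -> lker g == 0%VS -> lker (tens_map f g) == 0%VS.
Proof.
move=> f0 g0; apply: (@cancel_lker0 _ _ _ _ (tens_map f^-1 g^-1)).
by apply: tens_lfunP => v w; rewrite comp_lfunE !tens_mapE id_lfunE !lker0_lfunK.
Qed.

Lemma tpow_map_lker0 (I : finType) V (g : 'End(V)) :
  lker g == 0%VS -> lker (tpow_map I g) == 0%VS.
Proof.
move=> g0; apply: (@cancel_lker0 _ _ _ _ (tpow_map I g^-1)).
apply: tpow_lfunP => v; rewrite comp_lfunE !tpow_mapE id_lfunE.
(* The families [g^-1 (g (v i))] and [v i] agree only pointwise in [i], so the two pure tensors are
   compared coordinate by coordinate. *)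
by apply/ffunP => k; rewrite !tpureE; apply: eq_bigr => i _; rewrite lker0_lfunK.
Qed.

(** By [schur_mapE] the action on the Schur module is a restriction of the action on the tensor
    power, so it inherits injectivity. *)
Lemma schur_map_lker0 la V (g : 'End(V)) :
  lker g == 0%VS -> lker (schur_map la g) == 0%VS.
Proof.
move=> /(tpow_map_lker0 (box la))/lker0P g_inj; apply/lker0P => u v guv.
by apply/val_inj/g_inj; rewrite -[LHS]schur_mapE guv -[RHS]schur_mapE.
Qed.

End TensorPowers.

Section Rank.

Variable K : fieldType.
Implicit Types A B U V W : vectType K.

Lemma rank_compl U V W (f : 'Hom(V, W)) (g : 'Hom(U, V)) :
  lker f == 0%VS -> rank (f \o g)%VF = rank g.
Proof.
by move=> /eqP f0; rewrite /rank limg_comp limg_dim_eq // f0 capv0.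
Qed.

(** An injective endomorphism in finite dimension is onto, so [f] is still applied to the whole of
    [V]. *)
Lemma rank_compr V W (f : 'Hom(V, W)) (g : 'End(V)) :
  lker g == 0%VS -> rank (f \o g)%VF = rank f.
Proof.
move=> g0; rewrite /rank limg_comp; congr (\dim (f @: _)%VS).
by apply/eqP; rewrite eqEdim subvf limg_dim_eq //= (eqP g0) capv0.
Qed.

Lemma hom_mx_lker0 A (G : 'M[K]_(dim A)) : G \in unitmx -> lker (Hom G) == 0%VS.
Proof.
move=> G_unit; apply/lker0P => u v; rewrite unlock /= => /r2v_inj.
by move=> /(can_inj (mulmxK G_unit))/v2r_inj.
Qed.

(** Gaussian elimination factors the matrix of a map as L D R, with L and R invertible and D a
    partial identity depending only on the rank. Hence [X] and [Y] share the same D. *)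
Lemma rank_eq_GL A B (X Y : 'Hom(A, B)) : rank X = rank Y ->
  exists g h, [/\ in_GL g, in_GL h & hom_map g h X = Y].
Proof.
have rank_mx (Z : 'Hom(A, B)) : rank Z = \rank (f2mx Z).
  have -> : rank Z = \dim (mx2vs (vs2mx {:A} *m f2mx Z)) by rewrite /rank unlock.
  by rewrite /dimv /= genmxE (eqmxMr _ (genmxE _)) mul1mx.
rewrite !rank_mx => eq_rank.
(* Matrices act on row vectors from the right, so [Hom H \o X] has matrix [f2mx X *m H]. With X = L
   D R and Y = L' D R', the choices G = L L'^-1 and H = R^-1 R' give X H = L D R' = G Y. *)
pose G := col_ebase (f2mx X) *m invmx (col_ebase (f2mx Y)).
pose H := invmx (row_ebase (f2mx X)) *m row_ebase (f2mx Y).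
have g0 : lker (Hom G) == 0%VS.
  by rewrite hom_mx_lker0 // unitmx_mul unitmx_inv !col_ebase_unit.
have h0 : lker (Hom H) == 0%VS.
  by rewrite hom_mx_lker0 // unitmx_mul unitmx_inv !row_ebase_unit.
exists (Hom G), (Hom H); split=> //; rewrite hom_mapE.
suff -> : (Hom H \o X = Y \o Hom G)%VF by rewrite lker0_compfK.
apply/lfunP => v; rewrite !comp_lfunE unlock /= !r2vK -!mulmxA.
congr (r2v (_ *m _)).
rewrite /G /H -{1}(mulmx_ebase (f2mx X)) -{3}(mulmx_ebase (f2mx Y)) eq_rank.
by rewrite -!mulmxA mulKVmx ?row_ebase_unit // mulKmx ?col_ebase_unit.
Qed.

Lemma rank_slice_hom_map A B la la' mu mu'
    (Theta : 'Hom(tens 'Hom(A, B) (tens (schur la A) (schur mu B)),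
                  tens (schur la' A) (schur mu' B))) g h X :
  equivariant Theta -> in_GL g -> in_GL h ->
  rank (slice Theta (hom_map g h X)) = rank (slice Theta X).
Proof.
move=> Theta_equiv g_GL h_GL.
pose P := tens_map (schur_map la g) (schur_map mu h).
pose Q := tens_map (schur_map la' g) (schur_map mu' h).
have intertwine : (slice Theta (hom_map g h X) \o P = Q \o slice Theta X)%VF.
  apply/lfunP => w; rewrite !comp_lfunE !sliceE.
  (* On a pure tensor with first factor [X], the action on the source of [Theta] moves [X] to
     [hom_map g h X] and [w] to [P w]. *)
  have /lfunP/(_ (tpair X w)) := Theta_equiv _ _ g_GL h_GL.
  by rewrite !comp_lfunE tens_mapE.
(* Precomposing with the invertible [P] keeps the rank and exposes the left side of [intertwine];
   the invertible [Q] is then dropped on the other side. *)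
rewrite -(rank_compr _ (_ : lker P == 0%VS)); last first.
  by apply: tens_map_lker0; apply: schur_map_lker0.
rewrite intertwine rank_compl //.
by apply: tens_map_lker0; apply: schur_map_lker0.
Qed.

End Rank.

Theorem proposition18 (R : realType) (A B : vectType R[i])
    (la la' mu mu' : seq nat)
    (part_la : is_partition la) (part_la' : is_partition la')
    (part_mu : is_partition mu) (part_mu' : is_partition mu')
    (len_la : (size la <= \dim {:A})%N) (len_la' : (size la' <= \dim {:A})%N)
    (len_mu : (size mu <= \dim {:B})%N) (len_mu' : (size mu' <= \dim {:B})%N)
    (la_la' : remove_box la la') (mu_mu' : add_box mu mu')
    (Theta : 'Hom(tens 'Hom(A, B) (tens (schur la A) (schur mu B)),
                  tens (schur la' A) (schur mu' B)))
    (Theta_neq0 : Theta != 0) (Theta_equiv : equivariant Theta) :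
  (forall X Y : 'Hom(A, B),
     rank X = rank Y -> rank (slice Theta X) = rank (slice Theta Y)) /\
  (forall M : {vspace 'Hom(A, B)}, constant_rank M ->
     constant_rank_family M (slice Theta) /\
     constant_rank (slice_space Theta M)).
Proof.
have rank_slice (X Y : 'Hom(A, B)) :
    rank X = rank Y -> rank (slice Theta X) = rank (slice Theta Y).
  by move=> /rank_eq_GL[g [h [g_GL h_GL <-]]]; rewrite rank_slice_hom_map.
split=> // M M_const.
have slice_const : constant_rank_family M (slice Theta).
  by move=> X Y XM YM X0 Y0; apply: rank_slice; apply: M_const.
(* By linearity of [slice Theta], a nonzero member of [slice_space Theta M] comes from a nonzero
   parameter in [M], so the statement on the family applies. *)
split=> // _ _ /slice_spaceP[X XM ->] /slice_spaceP[Y YM ->] sX0 sY0.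
by apply: slice_const => //; [apply: contraNneq sX0 | apply: contraNneq sY0];
  move=> ->; rewrite linear0.
Qed.
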